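(* Let $d,\bar s\in\mathbb{Z}_+$ with $\bar s\le d/2$, let $\beta_{\min}>0$, $\sigma^2>0$, $0<\omega<1$ and $\delta\in(0,1/2)$. Let $\overline{\mathcal{M}}$ be the class of Gaussian linear models $(\beta,\Sigma,\sigma^2)$ with $\beta\in\Theta_{d}^{\bar s}(\beta_{\min})$ and $\Sigma\in\Omega_{d}^{\bar s}(\omega)$. Suppose one observes $n$ i.i.d. samples from $P_{\beta,\Sigma,\sigma^2}$ with $(\beta,\Sigma,\sigma^2)\in\overline{\mathcal{M}}$, where $$ n\ \le\ (1-2\delta)\times\frac{\log d}{\beta_{\min}^2\,\omega/\sigma^2}. $$ Then $$ \inf_{\widehat S}\ \sup_{(\beta,\Sigma,\sigma^2)\in\overline{\mathcal{M}}}\ \mathbb{P}_{\beta,\Sigma,\sigma^2}\big(\widehat S\ne S_*\big)\ \ge\ \delta-\frac{\log 2}{\log d}, $$ where $S_*=\operatorname{supp}(\beta)$ and the infimum is over all estimators $\widehat S$ of the support, i.e. all measurable functions of the $n$ samples with values in the subsets of $\{1,\dots,d\}$.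
   Context: Model: $P_{\beta,\Sigma,\sigma^2}$ is the law of $(X,Y)\in\mathbb{R}^d\times\mathbb{R}$ with $Y=X^\top\beta+\epsilon$, $X\sim\mathcal{N}(0,\Sigma)$, $\epsilon\sim\mathcal{N}(0,\sigma^2)$, $X$ independent of $\epsilon$. Let $\mathcal{S}_d^{\bar s}=\{S\subseteq\{1,\dots,d\}:|S|\le\bar s\}$. For $\Sigma$ positive definite and index sets $S,T$, $\Sigma_{ST}$ is the submatrix with rows $S$ and columns $T$, and $\Sigma_{S\setminus T\mid T}=\Sigma_{(S\setminus T)(S\setminus T)}-\Sigma_{(S\setminus T)T}\Sigma_{TT}^{-1}\Sigma_{T(S\setminus T)}$ (for $T=\emptyset$ this is $\Sigma_{SS}$). $\Theta_d^{\bar s}(\beta_{\min})=\{\beta\in\mathbb{R}^d:\ \|\beta\|_0\le\bar s,\ |\beta_j|\ge\beta_{\min}\text{ for all } j\in\operatorname{supp}(\beta)\}$, where $\|\beta\|_0=|\operatorname{supp}(\beta)|$. $\Omega_d^{\bar s}(\omega)$ is the set of $d\times d$ positive definite matrices $\Sigma$ with $\lambda_{\min}(\Sigma_{S\setminus T\mid T})\ge\omega$ for all $S,T\in\mathcal{S}_d^{\bar s}$ with $S\not\subseteq T$. The parameters $d,\bar s,\beta_{\min},\omega,\sigma^2$ defining $\overline{\mathcal{M}}$ are fixed. *)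

(* Defs.v *)
From HB Require Import structures.
From mathcomp Require Import all_boot all_order all_algebra.
From mathcomp Require Import all_classical all_reals all_analysis.
From mathcomp Require Import measurable_realfun.

Set Implicit Arguments.
Unset Strict Implicit.
Unset Printing Implicit Defensive.

Import Order.TTheory GRing.Theory Num.Theory.
Import numFieldNormedType.Exports.

Local Open Scope classical_set_scope.
Local Open Scope ring_scope.

Section product_power.
Context d (T : measurableType d) (R : realType).

Definition cons_pair n (x : T * n.-tuple T) : n.+1.-tuple T :=
  [the n.+1.-tuple T of x.1 :: x.2].

Lemma measurable_cons_pair n : measurable_fun [set: T * n.-tuple T] (@cons_pair n).
Proof. exact: measurable_cons. Qed.

HB.instance Definition _ n := isMeasurableFun.Build _ _ _ _
  (@cons_pair n) (@measurable_cons_pair n).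

(* The law of n independent draws from P, i.e. the n-fold product measure. *)
Fixpoint iid (P : probability T R) n : probability (n.-tuple T) R :=
  match n return probability (n.-tuple T) R with
  | 0 => \d_([tuple] : 0.-tuple T)
  | m.+1 => distribution (P \x iid P m)%E (@cons_pair m)
  end.

Lemma iid_rect (P : probability T R) n (A : 'I_n -> set T) :
  (forall i, measurable (A i)) ->
  iid P n [set x | forall i, A i (tnth x i)] = (\prod_(i < n) P (A i))%E.
Proof.
elim: n A => [A _|n IH A mA] /=.
  rewrite big_ord0 diracE mem_set //; by case.
rewrite big_ord_recl -(IH (fun i => A (lift ord0 i))) //.
rewrite /distribution /pushforward -product_measure1E //; last first.
  rewrite [X in measurable X](_ : _ = \bigcap_(i in [set: 'I_n])
     ((@tnth _ T ^~ i) @^-1` A (lift ord0 i))); last first.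
    by apply/seteqP; split=> x /= H i; [move=> _; exact: H | exact: H].
  apply: fin_bigcap_measurable => // i _.
  by rewrite -[X in measurable X]setTI; exact: measurable_tnth.
congr (_ _); apply/seteqP; split => [[x y] /= H|[x y] /= [H0 H] i].
  by split=> [|i]; [have := H ord0 | have := H (lift ord0 i)]; rewrite ?tnth0 ?tnthS.
by case: (unliftP ord0 i) => [j ->|->]; rewrite ?tnth0 ?tnthS.
Qed.

End product_power.

Section linear_algebra.
Context (R : realType).

Definition posdefmx n (A : 'M[R]_n) : Prop :=
  A^T = A /\ forall v : 'cV[R]_n, v != 0 -> 0 < (v^T *m A *m v) 0 0.

Lemma posdefmx_factor n (A : 'M[R]_n) :
  posdefmx A -> exists B : 'M[R]_n, B *m B^T = A.
Proof.
elim: n A => [A _|n IH]; first by exists 0; rewrite [LHS]flatmx0 [RHS]flatmx0.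
rewrite -[n.+1]/(1 + n)%N => A [symA posA].
pose a := A 0 0; pose u := dlsubmx A; pose C := drsubmx A.
have defA : A = block_mx a%:M u^T u C.
  rewrite -[LHS]submxK; congr block_mx.
    by rewrite [LHS]mx11_scalar !mxE !lshift0.
  by rewrite /u trmx_dlsub symA.
have symC : C^T = C by rewrite /C trmx_drsub symA.
have a_gt0 : 0 < a.
  have e0 : col_mx (1%:M : 'M[R]_1) (0 : 'cV[R]_n) != 0.
    by rewrite col_mx_eq0 oner_eq0.
  have := posA _ e0; rewrite defA tr_col_mx mul_row_block mul_row_col.
  by rewrite !(trmx0, mul0mx, mulmx0, addr0, trmx1, mul1mx, mulmx1) mxE eqxx.
have [|B defB] := IH (C - a^-1 *: (u *m u^T)).
  split=> [|w w0].
    by rewrite linearB linearZ /= symC trmx_mul trmxK.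
  pose t := - a^-1 *: (u^T *m w).
  have v0 : col_mx t w != 0 by rewrite col_mx_eq0 negb_and w0 orbT.
  have := posA _ v0; congr (is_true (0 < fun_of_matrix _ 0 0)).
  rewrite defA tr_col_mx mul_row_block mul_row_col.
  have -> : t^T = - a^-1 *: (w^T *m u) by rewrite linearZ /= trmx_mul trmxK.
  rewrite mul_mx_scalar scalerA mulrN mulfV ?gt_eqF // scaleN1r addNr mul0mx add0r.
  rewrite mulmxDl mulmxBr mulmxBl addrC; congr (_ + _).
  by rewrite -!scalemxAl -scalemxAr -scalemxAl scaleNr !mulmxA.
exists (block_mx (Num.sqrt a)%:M 0 ((Num.sqrt a)^-1 *: u) B).
rewrite defA tr_block_mx mulmx_block !trmx0 !mulmx0 !mul0mx !addr0.
have sa0 : Num.sqrt a != 0 by rewrite gt_eqF ?sqrtr_gt0.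
rewrite tr_scalar_mx -scalar_mxM -expr2 sqr_sqrtr ?ltW //.
congr block_mx.
- by rewrite linearZ /= mul_scalar_mx scalerA divff ?scale1r.
- by rewrite mul_mx_scalar scalerA divff ?scale1r.
rewrite linearZ /= -scalemxAl -scalemxAr scalerA -invfM -expr2 sqr_sqrtr ?ltW //.
by rewrite defB addrC subrK.
Qed.

Definition selmx d (Sigma : 'M[R]_d) (S T : {set 'I_d}) : 'M[R]_(#|S|, #|T|) :=
  mxsub (fun i : 'I_#|S| => enum_val i) (fun j : 'I_#|T| => enum_val j) Sigma.

Definition condmx d (Sigma : 'M[R]_d) (S T : {set 'I_d}) : 'M[R]_#|S :\: T| :=
  selmx Sigma (S :\: T) (S :\: T) -
  selmx Sigma (S :\: T) T *m invmx (selmx Sigma T T) *m selmx Sigma T (S :\: T).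

(* For a real symmetric matrix of positive size the set of eigenvalues is
   finite and nonempty, so that the infimum is a minimum. *)
Definition lambda_min n (A : 'M[R]_n) : R := inf [set a | eigenvalue A a].

End linear_algebra.

Section gaussian_linear_model.
Context (R : realType).

(* The library's normal_prob lives on the alias measurableTypeR R; its second
   argument is the standard deviation. *)
Let idTR : measurableTypeR R -> R := idfun.

#[local] HB.instance Definition _ :=
  @isMeasurableFun.Build _ _ _ _ idTR (@measurable_id _ _ setT).

Definition gauss (m s : R) : probability R R :=
  distribution (normal_prob m s) idTR.

Lemma gaussE m s (U : set R) : gauss m s U = normal_prob m s U.
Proof. by []. Qed.

Definition mulmx_tuple d (A : 'M[R]_d) (z : d.-tuple R) : d.-tuple R :=
  [tuple \sum_(j < d) A i j * tnth z j | i < d].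

Lemma measurable_mulmx_tuple d (A : 'M[R]_d) :
  measurable_fun [set: d.-tuple R] (mulmx_tuple A).
Proof.
apply/measurable_fun_tnthP => i; rewrite /mulmx_tuple.
rewrite (_ : _ \o _ = fun z : d.-tuple R => \sum_(j < d) A i j * tnth z j).
  apply: measurable_sum => j; apply: measurable_funM => //.
  exact: measurable_tnth.
by apply/funext => z /=; rewrite tnth_mktuple.
Qed.

HB.instance Definition _ d (A : 'M[R]_d) := isMeasurableFun.Build _ _ _ _
  (mulmx_tuple A) (measurable_mulmx_tuple A).

(* N(0, Sigma) is the law of A Z, where Z has d independent N(0, 1)
   coordinates and A *m A^T = Sigma. Such an A exists by posdefmx_factor
   when Sigma is positive definite, and the law does not depend on which one
   is taken, by the rotation invariance of the law of Z. *)
Definition mvnormal d (Sigma : 'M[R]_d) : probability (d.-tuple R) R :=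
  distribution (iid (gauss 0 1) d)
    (mulmx_tuple (xget 0 [set A : 'M[R]_d | A *m A^T = Sigma])).

Definition respond d (beta : 'cV[R]_d) (xe : d.-tuple R * R) : d.-tuple R * R :=
  (xe.1, \sum_(j < d) tnth xe.1 j * beta j 0 + xe.2).

Lemma measurable_respond d (beta : 'cV[R]_d) :
  measurable_fun [set: d.-tuple R * R] (respond beta).
Proof.
apply: measurable_fun_pair => //=; apply: measurable_funD => //.
apply: measurable_sum => j; apply: measurable_funM => //.
by apply: (measurableT_comp (measurable_tnth j)).
Qed.

HB.instance Definition _ d (beta : 'cV[R]_d) := isMeasurableFun.Build _ _ _ _
  (respond beta) (measurable_respond beta).

Definition linear_model d (beta : 'cV[R]_d) (Sigma : 'M[R]_d) (sigma2 : R) :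
    probability (d.-tuple R * R)%type R :=
  distribution (mvnormal Sigma \x gauss 0 (Num.sqrt sigma2))%E
    (respond beta).

Definition supp d (beta : 'cV[R]_d) : {set 'I_d} :=
  [set j | beta j 0 != 0]%SET.

Definition Theta d (sbar : nat) (beta_min : R) : set 'cV[R]_d :=
  [set beta | (#|supp beta| <= sbar)%N /\
    forall j, j \in supp beta -> beta_min <= `|beta j 0| ].

Definition Omega d (sbar : nat) (omega : R) : set 'M[R]_d :=
  [set Sigma | posdefmx Sigma /\
    forall S T : {set 'I_d}, (#|S| <= sbar)%N -> (#|T| <= sbar)%N ->
      ~~ (S \subset T) -> omega <= lambda_min (condmx Sigma S T)].

Definition Mbar d (sbar : nat) (beta_min omega sigma2 : R) :
    set ('cV[R]_d * 'M[R]_d * R) :=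
  [set theta | [/\ Theta sbar beta_min theta.1.1,
                   Omega sbar omega theta.1.2 & theta.2 = sigma2]].

(* Measurability with respect to the discrete sigma-algebra on the finite type
   of subsets of {1, ..., d}. *)
Definition estimator d n : set (n.-tuple (d.-tuple R * R) -> {set 'I_d}) :=
  [set Shat | forall U : set {set 'I_d}, measurable (Shat @^-1` U)].

Definition error_prob d n (Shat : n.-tuple (d.-tuple R * R) -> {set 'I_d})
    (theta : 'cV[R]_d * 'M[R]_d * R) : \bar R :=
  iid (linear_model theta.1.1 theta.1.2 theta.2) n
    [set x | Shat x != supp theta.1.1].

End gaussian_linear_model.

Arguments Mbar {R} d sbar beta_min omega sigma2.
Arguments estimator R d n : clear implicits.

(* Main.v *)
(* Fano's argument over the d hypotheses beta = beta_min e_j with covariance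
   omega I: by the chain rule, the law of the n samples has Kullback-Leibler
   divergence K = n beta_min^2 omega / (2 sigma^2) <= (1/2 - delta) log d from
   the law under beta = 0. If A_j is the event that {j} is selected, testing the
   Donsker-Varadhan inequality on 1 + (d - 1) 1_{A_j} and averaging over j, with
   the A_j disjoint, shows that the average probability of A_j is at most
   (K + log 2) / log d. *)

Require Import Defs.
From mathcomp Require Import all_boot all_order all_algebra.
From mathcomp Require Import all_classical all_reals all_analysis.
From mathcomp Require Import measurable_realfun ring lra.

Set Implicit Arguments.
Unset Strict Implicit.
Unset Printing Implicit Defensive.

Import Order.TTheory GRing.Theory Num.Theory.
Import numFieldNormedType.Exports.

Local Open Scope classical_set_scope.
Local Open Scope ring_scope.

(** * Change of measure between normal laws of equal variance *)

Section gaussian_tilting.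
Context (R : realType).
Implicit Types (m s c : R).

(** The Radon-Nikodym derivative of [normal_prob] and [normal_pdf] have the same integral over every
    measurable set, so they agree almost everywhere. *)
Lemma ge0_integral_normal_prob m s (f : measurableTypeR R -> \bar R) :
  measurable_fun setT f -> (forall x, 0 <= f x)%E ->
  (\int[normal_prob m s]_x f x =
   \int[lebesgue_measure]_x (f x * (normal_pdf m s x)%:E))%E.
Proof.
move=> mf f0; have dom := normal_prob_dominates m s.
have mpdf : measurable_fun setT (fun x : measurableTypeR R => (normal_pdf m s x)%:E).
  by apply/measurableT_comp => //; exact: measurable_normal_pdf.
rewrite -(Radon_Nikodym_SigmaFinite.change_of_variables dom)//.
have iRN := Radon_Nikodym_SigmaFinite.f_integrable dom.
apply: ae_eq_integral => //.
- by apply: emeasurable_funM => //; exact: (measurable_int _ iRN).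
- exact: emeasurable_funM.
apply: ae_eqe_mul2l; apply: integral_ae_eq => // E _ mE.
by rewrite -Radon_Nikodym_SigmaFinite.f_integral.
Qed.

Lemma ge0_integral_gauss m s (f : R -> \bar R) :
  measurable_fun setT f -> (forall x, 0 <= f x)%E ->
  (\int[gauss m s]_x f x =
   \int[lebesgue_measure]_x (f x * (normal_pdf m s x)%:E))%E.
Proof.
move=> mf f0; rewrite -ge0_integral_normal_prob//.
by rewrite ge0_integral_pushforward.
Qed.

Lemma normal_pdf_shift m s c x : s != 0 ->
  normal_pdf (m + c) s x =
  expR ((c * (x - m) - c ^+ 2 / 2) / s ^+ 2) * normal_pdf m s x.
Proof.
move=> s0; rewrite !normal_pdfE// mulrCA -expRD; congr (_ * expR _).
by field.
Qed.

Lemma integral_gauss_shift m s c (f : R -> \bar R) : s != 0 ->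
  measurable_fun setT f -> (forall x, 0 <= f x)%E ->
  (\int[gauss (m + c) s]_x f x =
   \int[gauss m s]_x
     (f x * (expR ((c * (x - m) - c ^+ 2 / 2) / s ^+ 2))%:E))%E.
Proof.
move=> s0 mf f0; have mtilt : measurable_fun [set: R]
    (fun x => f x * (expR ((c * (x - m) - c ^+ 2 / 2) / s ^+ 2))%:E)%E.
  apply: emeasurable_funM => //; apply/measurable_EFinP.
  apply: measurableT_comp => //; apply: measurable_funM => //.
  apply: measurable_funB => //; apply: measurable_funM => //.
  exact: measurable_funB.
rewrite (ge0_integral_gauss _ _ mf f0) (ge0_integral_gauss _ _ mtilt); last first.
  by move=> x; rewrite mule_ge0// lee_fin expR_ge0.
by apply: eq_integral => x _; rewrite normal_pdf_shift// EFinM muleA.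
Qed.

(** The moment generating function without computing an integral: up to a constant factor, the
    integrand is the density of [gauss (m + c) s] relative to [gauss m s], and that law has mass
    1. *)
Lemma integral_gauss_expR m s c : s != 0 ->
  (\int[gauss m s]_x (expR (c * (x - m) / s ^+ 2))%:E =
   (expR (c ^+ 2 / 2 / s ^+ 2))%:E)%E.
Proof.
move=> s0.
have <- : (\int[gauss (m + c) s]_x (cst (expR (c ^+ 2 / 2 / s ^+ 2))%:E) x =
    (expR (c ^+ 2 / 2 / s ^+ 2))%:E)%E.
  rewrite integral_cst; last exact: measurableT.
  by rewrite [X in (_ * X)%E]probability_setT mule1.
rewrite (integral_gauss_shift m c s0); first last.
- by move=> x; rewrite lee_fin expR_ge0.
- exact: measurable_cst.
- apply: eq_integral => x _; rewrite -EFinM -expRD; congr (expR _)%:E.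
  by field.
Qed.

End gaussian_tilting.

(** * First-order comparison with an exponential *)

Section linearization.
Context (R : realType).

(* Compares first-order terms at t = 0. *)
Lemma expR_linearize (a b c : R) : 0 <= b -> 0 <= c ->
  (forall t, 0 < t -> a * t <= expR (t * b + t ^+ 2 * c) - 1) -> a <= b.
Proof.
move=> b0 c0 H; rewrite leNgt; apply/negP => ab.
(* [M] and [t] ensure [t <= 1] and [2 * (1 + a) * (b + c) * t < a - b]; the second-order terms are
   then too small to fill the gap [a - b]. *)
pose M := 2 * (1 + a) * (1 + b + c).
have M1 : 1 <= M by rewrite /M; nra.
pose t := (a - b) / (M * (1 + a - b)).
have D0 : 0 < M * (1 + a - b) by rewrite mulr_gt0//; lra.
have t0 : 0 < t by rewrite divr_gt0// subr_gt0.
have tE : t * (M * (1 + a - b)) = a - b by rewrite divfK// gt_eqF.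
have {}H := H t t0; set u := t * b + _ in H.
have tM : t * M <= a - b by nra.
have t1 : t <= 1 by nra.
have tc : t * c <= c by rewrite ler_piMl.
have uE : u = t * (b + t * c) by rewrite /u; ring.
have ut : u <= t * (b + c) by rewrite uE ler_pM2l//; lra.
have ub : t * (b + c) * 2 * (1 + a) < a - b by rewrite /M in tM; nra.
(* From [1 - u <= expR (- u)]. With [H] it turns into the polynomial bound
   [(1 + a * t) * (1 - u) <= 1], which fails at this [t]. *)
have eu : expR u * (1 - u) <= 1.
  rewrite -[leRHS](@expRxMexpNx_1 _ u) ler_pM2l ?expR_gt0//.
  exact: expR_ge1Dx.
have u1 : u < 1 by nra.
have : (1 + a * t) * (1 - u) <= 1 by nra.
rewrite leNgt => /negP; apply.
suff : u * (1 + a * t) < a * t by nra.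
rewrite uE -mulrA [a * t]mulrC ltr_pM2l//.
nra.
Qed.
End linearization.

(** * Divergence in dual form: Jensen's inequality and the chain rule *)

Section kullback_leibler.
Context (R : realType).

Lemma le_integral_EFin d (T : measurableType d) (P : probability T R)
    (f g : T -> R) : measurable_fun setT f -> measurable_fun setT g ->
  (forall x, 0 <= f x <= g x) ->
  (\int[P]_x (f x)%:E <= \int[P]_x (g x)%:E)%E.
Proof.
move=> mf mg fg; apply: ge0_le_integral => //.
- by move=> x _; rewrite lee_fin; case/andP: (fg x).
- exact/measurable_EFinP.
- exact/measurable_EFinP.
- by move=> x _; rewrite lee_fin; case/andP: (fg x).
Qed.

Lemma integral_cst_EFin d (T : measurableType d) (P : probability T R) (r : R) :
  (\int[P]_x r%:E = r%:E)%E.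
Proof. by rewrite [LHS]integral_cst// [X in (_ * X)%E]probability_setT mule1. Qed.

Lemma integral_bounded d (T : measurableType d) (P : probability T R)
    (g : T -> R) (M : R) : measurable_fun setT g ->
  (forall x, 1 <= g x <= M) ->
  exists2 Z, (\int[P]_x (g x)%:E = Z%:E)%E & 1 <= Z <= M.
Proof.
move=> mg gM.
have lo : (1%:E <= \int[P]_x (g x)%:E)%E.
  rewrite -[leLHS](integral_cst_EFin P) le_integral_EFin// => x.
  by rewrite ler01; case/andP: (gM x).
have hi : (\int[P]_x (g x)%:E <= M%:E)%E.
  rewrite -[leRHS](integral_cst_EFin P) le_integral_EFin// => x.
  by case/andP: (gM x) => /(le_trans ler01) -> ->.
move: lo hi; case: (\int[P]_x _)%E => [Z||//]; last by rewrite leye_eq.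
by rewrite !lee_fin => lo hi; exists Z => //; rewrite lo.
Qed.

(* The Kullback-Leibler divergence of P from Q is at most k, in the dual form
   of Donsker and Varadhan; test functions are bounded and at least 1 so that
   only nonnegative functions are integrated. *)
Definition kl_le d (T : measurableType d) (P Q : probability T R) (k : R) :=
  forall (g : T -> R) (M : R), measurable_fun setT g ->
    (forall x, 1 <= g x <= M) ->
    (\int[P]_x (ln (g x))%:E <= (k + ln (fine (\int[Q]_x (g x)%:E)))%:E)%E.

(** Concavity of [ln]. Both sides are nonnegative once [x] and [z] are at least 1, so the bound can
    be integrated with nonnegative integrands only. *)
Lemma ln_tangent (x z : R) : 0 < x -> 0 < z -> ln x + 1 <= ln z + x / z.
Proof.
move=> x0 z0; have xz : 0 < x / z by rewrite divr_gt0.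
have : ln (x / z) <= x / z - 1.
  by rewrite -[X in ln X](subrKC 1) le_ln1Dx//; lra.
by rewrite ln_div//; lra.
Qed.

(** This is Jensen's inequality for [ln]: its tangent at the mean [Z] of [g] is integrated. *)
Lemma kl_le_refl d (T : measurableType d) (P : probability T R) : kl_le P P 0.
Proof.
move=> g M mg gM; rewrite add0r.
have [Z ZE /andP[Z1 _]] := integral_bounded P mg gM; rewrite ZE /=.
have g1 x : 1 <= g x by case/andP: (gM x).
have Z0 : 0 < Z by lra.
have mln : measurable_fun setT (fun x => ln (g x)) by exact: measurableT_comp.
have gE : (\int[P]_x (ln (g x) + 1)%:E <= \int[P]_x (ln Z + g x / Z)%:E)%E.
  apply: le_integral_EFin => [||x].
  - exact: measurable_funD.
  - by apply: measurable_funD => //; exact: measurable_funM.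
  - by rewrite addr_ge0 ?ln_ge0//= ln_tangent//; have := g1 x; lra.
move: gE; under eq_integral do rewrite EFinD.
under [X in (_ <= X)%E]eq_integral do rewrite EFinD mulrC EFinM.
have mlnE : measurable_fun setT (fun x => (ln (g x))%:E) by exact/measurable_EFinP.
have mgE : measurable_fun setT (fun x => (g x)%:E) by exact/measurable_EFinP.
have g0 x : (0 <= (g x)%:E)%E by rewrite lee_fin (le_trans ler01).
have Zi0 : (0 <= (Z^-1)%:E)%E by rewrite lee_fin invr_ge0 ltW.
rewrite ge0_integralD//; last by move=> x _; rewrite lee_fin ln_ge0.
rewrite ge0_integralD//; first last.
- exact: emeasurable_funM.
- by move=> x _; rewrite mule_ge0.
- by move=> x _; rewrite lee_fin ln_ge0.
rewrite ge0_integralZl// ZE -EFinM mulVf ?gt_eqF// !integral_cst_EFin.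
by rewrite leeD2rE.
Qed.

(* Chain rule: the conditional laws given the first coordinate are at
   divergence at most k x. *)
Lemma kl_le_mixture d1 d2 d3 (T1 : measurableType d1) (T2 : measurableType d2)
    (U : measurableType d3) (P1 Q1 : probability T1 R) (P2 Q2 : probability T2 R)
    (f1 f2 : {mfun (T1 * T2)%type >-> U}) (k : T1 -> R) (k1 k2 : R) :
  measurable_fun setT k -> (forall x, 0 <= k x) ->
  (\int[P1]_x (k x)%:E <= k2%:E)%E ->
  kl_le P1 Q1 k1 ->
  (forall x (g : U -> R) (M : R), measurable_fun setT g ->
    (forall u, 1 <= g u <= M) ->
    (\int[P2]_y (ln (g (f1 (x, y))))%:E <=
     (k x + ln (fine (\int[Q2]_y (g (f2 (x, y)))%:E)))%:E)%E) ->
  kl_le (distribution (P1 \x P2)%E f1) (distribution (Q1 \x Q2)%E f2) (k1 + k2).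
Proof.
move=> mk k0 kk2 kl1 kl2 g M mg gM.
have g1 u : 1 <= g u by case/andP: (gM u).
have mgf2 : measurable_fun setT (fun z => (g (f2 z))%:E).
  by apply/measurable_EFinP; exact: measurableT_comp.
have mlng : measurable_fun setT (fun u => (ln (g u))%:E).
  by apply/measurable_EFinP; exact: measurableT_comp.
have mlngf1 : measurable_fun setT (fun z => (ln (g (f1 z)))%:E).
  exact: (measurableT_comp mlng).
have ln0 u : (0 <= (ln (g u))%:E)%E by rewrite lee_fin ln_ge0.
have g0 u : (0 <= (g u)%:E)%E by rewrite lee_fin (le_trans ler01).
pose h x := fine (\int[Q2]_y (g (f2 (x, y)))%:E).
(* Integrating out the second coordinate under [Q2] keeps values in [[1, M]], so [h] is an
   admissible test function for [P1] and [Q1]. *)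
have hE x : (\int[Q2]_y (g (f2 (x, y)))%:E = (h x)%:E)%E /\ 1 <= h x <= M.
  rewrite /h; have [||Z -> //] := @integral_bounded _ _ Q2 (fun y => g (f2 (x, y))) M.
  - by apply: measurableT_comp => //; exact: measurableT_comp.
  - by move=> y; exact: gM.
have mF : measurable_fun setT (fubini_F Q2 (fun z => (g (f2 z))%:E)).
  by apply: measurable_fun_fubini_tonelli_F => // z.
have mh : measurable_fun setT h.
  apply/measurable_EFinP; apply: eq_measurable_fun mF => x _.
  by rewrite /fubini_F (hE x).1.
have Q2E : (\int[distribution (Q1 \x Q2) f2]_u (g u)%:E =
            \int[Q1]_x (h x)%:E)%E.
  rewrite ge0_integral_distribution//; last exact/measurable_EFinP.
  rewrite [LHS](fubini_tonelli1 (fun z => (g (f2 z))%:E))//.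
  by apply: eq_integral => x _; rewrite /fubini_F (hE x).1.
rewrite Q2E ge0_integral_distribution//.
rewrite [leLHS](fubini_tonelli1 (fun z => (ln (g (f1 z)))%:E))//.
have mkE : measurable_fun setT (fun x => (k x)%:E) by exact/measurable_EFinP.
have mlnh : measurable_fun setT (fun x => (ln (h x))%:E).
  by apply/measurable_EFinP; exact: measurableT_comp.
have lnh0 x : (0 <= (ln (h x))%:E)%E.
  by rewrite lee_fin ln_ge0//; case/andP: (hE x).2.
(* The conditional bound is used for each fixed [x]; afterwards [kl1] is applied to [h]. *)
apply: (@le_trans _ _ (\int[P1]_x ((k x)%:E + (ln (h x))%:E))%E).
  apply: ge0_le_integral => //.
  - by move=> x _; apply: integral_ge0.
  - by apply: measurable_fun_fubini_tonelli_F => // z.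
  - exact: emeasurable_funD.
  - by move=> x _; exact: kl2 x g M mg gM.
rewrite ge0_integralD//; last by move=> x _; rewrite lee_fin.
rewrite (addrC k1) -(addrA k2) EFinD leeD//.
by apply: (kl1 h M) => // x; exact: (hE x).2.
Qed.

End kullback_leibler.

(** * Divergence of normal laws with different means *)

Section gaussian_divergence.
Context (R : realType).

Lemma lebesgue_measure_shift (c : R) (A : set (measurableTypeR R)) : measurable A ->
  pushforward (@lebesgue_measure R)
    (fun x : measurableTypeR R => c + x : measurableTypeR R) A = lebesgue_measure A.
Proof.
move=> mA.
have mc : measurable_fun setT (fun x : measurableTypeR R => c + x : measurableTypeR R).
  exact: measurable_funD.
apply/esym; apply: lebesgue_measure_unique mA => // _ [[a b]] _ <-.
transitivity (@lebesgue_measure R `]a - c, b - c]%classic).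
  rewrite !lebesgue_measure_itv/= !lte_fin ltrD2r; case: ifP => // _.
  by rewrite -!EFinB; congr EFin; ring.
congr lebesgue_measure; apply/seteqP.
split=> x /=; rewrite !in_itv/= => /andP[? ?]; apply/andP; split; lra.
Qed.

Lemma normal_pdf_translate (s c x : R) :
  s != 0 -> normal_pdf c s (c + x) = normal_pdf 0 s x.
Proof.
by move=> s0; rewrite !normal_pdfE// /normal_fun subr0 addrC addKr.
Qed.

(** A change of variable, where [integral_gauss_shift] is a change of measure: it identifies the law
    of [c] plus centred noise, by translation invariance of Lebesgue measure. *)
Lemma integral_gauss_translate (s c : R) (f : R -> \bar R) : s != 0 ->
  measurable_fun setT f -> (forall x, 0 <= f x)%E ->
  (\int[gauss 0 s]_x f (c + x)%R = \int[gauss c s]_x f x)%E.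
Proof.
move=> s0 mf f0.
have mfc : measurable_fun setT (fun x => f (c + x)).
  by apply: (measurableT_comp mf); exact: measurable_funD.
have mfp : measurable_fun setT
    (fun x : measurableTypeR R => f x * (normal_pdf c s x)%:E)%E.
  apply: emeasurable_funM => //; apply/measurable_EFinP.
  exact: measurable_normal_pdf.
have fc0 x : (0 <= f (c + x)%R)%E by [].
rewrite [LHS](ge0_integral_gauss 0 s mfc fc0) [RHS](ge0_integral_gauss c s mf f0).
pose sh (x : measurableTypeR R) : measurableTypeR R := c + x.
transitivity (\int[pushforward (@lebesgue_measure R) sh]_x
    (f x * (normal_pdf c s x)%:E))%E.
  have msh : measurable_fun setT sh by exact: measurable_funD.
  have fp0 : {in [set: measurableTypeR R],
      forall x, 0 <= f x * (normal_pdf c s x)%:E}%E.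
    by move=> x _; rewrite mule_ge0// lee_fin normal_pdf_ge0.
  rewrite [RHS](ge0_integral_pushforward msh (@lebesgue_measure R) measurableT mfp fp0).
  by apply: eq_integral => x _; rewrite /= /sh normal_pdf_translate.
apply: eq_measure_integral => [|msh A mA _]; first exact: measurable_funD.
exact: (lebesgue_measure_shift c mA).
Qed.

(** With [ell] the log-likelihood ratio, the tangent of [ln] at [Z * expR (ell x)] gives [ln g <= ln
    Z + ell + g * expR (- ell) / Z - 1]. Under [gauss m s] the mean of [ell] is the bound sought,
    and [g * expR (- ell) / Z] has mean 1. *)
Lemma kl_le_gauss (m s : R) : s != 0 ->
  kl_le (gauss m s) (gauss 0 s) (m ^+ 2 / 2 / s ^+ 2).
Proof.
move=> s0 g M mg gM.
have g1 x : 1 <= g x by case/andP: (gM x).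
have [Z ZE /andP[Z1 _]] := integral_bounded (gauss 0 s) mg gM; rewrite ZE /=.
have Z0 : 0 < Z by lra.
have mlng : measurable_fun setT (fun x => ln (g x)) by exact: measurableT_comp.
pose ell x := (m * x - m ^+ 2 / 2) / s ^+ 2.
have mell : measurable_fun setT ell.
  by apply: measurable_funM => //; apply: measurable_funB => //; exact: measurable_funM.
(* Finite because [ln g <= g] and [g] is bounded. *)
have [I IE I0] : exists2 I : R, (\int[gauss m s]_x (ln (g x))%:E = I%:E)%E & 0 <= I.
  have [Y YE _] := integral_bounded (gauss m s) mg gM.
  have : (\int[gauss m s]_x (ln (g x))%:E <= Y%:E)%E.
    rewrite -YE; apply: le_integral_EFin => // x.
    by rewrite ln_ge0//= ltW// ln_sublinear//; have := g1 x; lra.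
  have : (0 <= \int[gauss m s]_x (ln (g x))%:E)%E.
    by apply: integral_ge0 => x _; rewrite lee_fin ln_ge0.
  case: (\int[gauss m s]_x _)%E => [I||//]; last by rewrite leye_eq.
  by rewrite !lee_fin; exists I.
rewrite IE lee_fin -lerBlDr.
set b := m ^+ 2 / 2 / s ^+ 2.
have b0 : 0 <= b by rewrite !divr_ge0 ?sqr_ge0.
(* Under [gauss m s], [ell] is normal with mean [b] and variance [2 * b], whence the exponential
   moment [expR (t * b + t ^+ 2 * b)]. *)
apply: (@expR_linearize _ _ b b) => // t t0.
(* The log-likelihood ratio ell changes sign; it is bounded by the nonnegative
   function (expR (t * ell) - 1) / t, up to a constant, and t tends to 0. *)
pose e1 x := t^-1 * expR (t * ell x).
pose e2 x := Z^-1 * (g x * expR (- ell x)).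
have me1 : measurable_fun setT e1.
  apply: measurable_funM => //; apply: measurableT_comp => //.
  exact: measurable_funM.
have me2 : measurable_fun setT e2.
  apply: measurable_funM => //; apply: measurable_funM => //.
  by apply: measurableT_comp => //; exact: measurableT_comp.
have e1_0 x : 0 <= e1 x by rewrite mulr_ge0 ?expR_ge0// invr_ge0 ltW.
have e2_0 x : 0 <= e2 x.
  by rewrite !mulr_ge0 ?expR_ge0// ?invr_ge0 ?ltW//; have := g1 x; lra.
(* The tangent bound, with [ell] eliminated through [1 + t * ell x <= expR (t * ell x)]. *)
have key x : ln (g x) + (1 + t^-1) <= ln Z + (e1 x + e2 x).
  have gx0 : 0 < g x by have := g1 x; lra.
  have := ln_tangent gx0 (mulr_gt0 Z0 (expR_gt0 (ell x))).
  rewrite lnM ?posrE ?expR_gt0// expRK /e2 expRN invfM => H1.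
  have : t^-1 + ell x <= e1 x.
    rewrite /e1 -[X in _ + X](mulKf (lt0r_neq0 t0)) -{1}[t^-1]mulr1 -mulrDr.
    by rewrite ler_pM2l ?invr_gt0// expR_ge1Dx.
  have : g x * (Z^-1 / expR (ell x)) = Z^-1 * (g x / expR (ell x)) by ring.
  by lra.
have e1I : (\int[gauss m s]_x (e1 x)%:E = (t^-1 * expR (t * b + t ^+ 2 * b))%:E)%E.
  pose h x := expR (t * m * (x - m) / s ^+ 2).
  have mh : measurable_fun setT (fun x => (h x)%:E).
    apply/measurable_EFinP; apply: measurableT_comp => //.
    by apply: measurable_funM => //; apply: measurable_funM => //; exact: measurable_funB.
  transitivity (\int[gauss m s]_x ((t^-1 * expR (t * b))%:E * (h x)%:E))%E.
    apply: eq_integral => x _; rewrite -EFinM /e1 -[X in _ = X%:E]mulrA -expRD.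
    by congr (_ * expR _)%:E; rewrite /ell /b; field.
  rewrite ge0_integralZl//; last 2 first.
  - by move=> x _; rewrite lee_fin expR_ge0.
  - by rewrite lee_fin mulr_ge0 ?expR_ge0// invr_ge0 ltW.
  rewrite integral_gauss_expR// -EFinM -[X in X%:E = _]mulrA -expRD.
  by congr (_ * expR _)%:E; rewrite /b; field.
have e2I : (\int[gauss m s]_x (e2 x)%:E = 1%:E)%E.
  have me : measurable_fun setT (fun x => (g x * expR (- ell x))%:E).
    apply/measurable_EFinP; apply: measurable_funM => //.
    by apply: measurableT_comp => //; exact: measurableT_comp.
  have e0 x : (0 <= (g x * expR (- ell x))%:E)%E.
    by rewrite lee_fin mulr_ge0 ?expR_ge0//; have := g1 x; lra.
  under eq_integral do rewrite /e2 EFinM.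
  rewrite ge0_integralZl//; last by rewrite lee_fin invr_ge0 ltW.
  (* The tilt from mean 0 to mean [m] is [expR (ell x)], which cancels [expR (- ell x)]. *)
  rewrite -{1}[m]add0r (integral_gauss_shift 0 m s0 me e0).
  rewrite (_ : (\int[gauss 0 s]_x _)%E = Z%:E).
    by rewrite -EFinM mulVf// gt_eqF.
  rewrite -ZE; apply: eq_integral => x _.
  by rewrite subr0 -EFinM -mulrA -expRD addNr expR0 mulr1.
have : (\int[gauss m s]_x (ln (g x) + (1 + t^-1))%:E <=
        \int[gauss m s]_x (ln Z + (e1 x + e2 x))%:E)%E.
  apply: le_integral_EFin => [||x].
  - exact: measurable_funD.
  - by apply: measurable_funD => //; exact: measurable_funD.
  - by rewrite key andbT addr_ge0 ?ln_ge0// addr_ge0// invr_ge0 ltW.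
under eq_integral do rewrite EFinD.
under [X in (_ <= X)%E]eq_integral do rewrite !EFinD.
have me1E : measurable_fun setT (fun x => (e1 x)%:E) by exact/measurable_EFinP.
have me2E : measurable_fun setT (fun x => (e2 x)%:E) by exact/measurable_EFinP.
have mlnE : measurable_fun setT (fun x => (ln (g x))%:E) by exact/measurable_EFinP.
rewrite ge0_integralD//; last 2 first.
- by move=> x _; rewrite lee_fin ln_ge0.
- by move=> x _; rewrite lee_fin addr_ge0// invr_ge0 ltW.
rewrite ge0_integralD//; last 3 first.
- by move=> x _; rewrite lee_fin ln_ge0.
- by move=> x _; rewrite adde_ge0// lee_fin.
- exact: emeasurable_funD.
rewrite ge0_integralD//; last 2 first.
- by move=> x _; rewrite lee_fin.
- by move=> x _; rewrite lee_fin.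
rewrite IE e1I e2I !integral_cst_EFin -!EFinD lee_fin => H.
have : (I - ln Z) * t <= (t^-1 * expR (t * b + t ^+ 2 * b) - t^-1) * t.
  by rewrite ler_pM2r//; lra.
by rewrite [X in _ <= X]mulrBl mulrAC mulVf ?gt_eqF// mul1r.
Qed.

End gaussian_divergence.

(** * Second moments from exponential moments *)

Section gaussian_second_moment.
Context (R : realType).

Lemma expR_ge2 (v : R) : 0 <= v -> 1 + v + v ^+ 2 / 2 <= expR v.
Proof.
move=> v0; have : series (exp_coeff v) 3 <= expR v.
  apply: nondecreasing_cvgn_le; last exact: is_cvg_series_exp_coeff.
  apply: nondecreasing_series => n _ _.
  by rewrite /exp_coeff/= divr_ge0// exprn_ge0.
rewrite /series/= /exp_coeff/= !big_nat_recr//= big_geq// add0r.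
by rewrite !factS !fact0 expr0 expr1 !divr1.
Qed.

(** With [u = 2 * v], the right side minus 2 is [(expR v - expR (- v)) ^+ 2], so it suffices that
    sinh v is at least v for [0 <= v]. *)
Lemma sqr_le_cosh (u : R) : u ^+ 2 + 2 <= expR u + expR (- u).
Proof.
wlog u0 : u / 0 <= u.
  move=> H; case: (leP 0 u) => [/H//|/ltW u0].
  have := H (- u); rewrite oppr_ge0 opprK sqrrN => /(_ u0).
  by rewrite [X in _ <= X]addrC.
pose v := u / 2; have v0 : 0 <= v by rewrite divr_ge0.
have E1 : expR v * expR (- v) = 1 by rewrite expRxMexpNx_1.
have -> : u = v + v by rewrite /v; lra.
rewrite opprD !expRD.
have H1 := expR_ge2 v0; have H2 := expR_gt0 (- v).
have H3 : 2 * v <= expR v - expR (- v).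
  (* Since y - 1/y increases with y, [expR v] may be replaced by its lower bound [p]; then p - 1/p
     is at least 2v by the identity [H5]. *)
  set p := 1 + v + v ^+ 2 / 2 in H1.
  have p1 : 1 <= p by rewrite /p; nra.
  have H4 : p * expR (- v) <= 1 by rewrite -E1 ler_pM2r.
  have H5 : p ^+ 2 - 1 - 2 * v * p = v ^+ 4 / 4.
    by rewrite /p; field.
  have H6 : 0 <= v ^+ 4 by rewrite exprn_ge0.
  suff : 2 * v * p <= (expR v - expR (- v)) * p by rewrite ler_pM2r//; lra.
  have : p * p <= expR v * p by rewrite ler_pM2r//; lra.
  by lra.
nra.
Qed.

(** Integrating [sqr_le_cosh] at [t * W x] bounds [t ^+ 2] times the second moment by
    [2 * expR (t ^+ 2 * v / 2) - 2]; first-order terms in [t ^+ 2] are then compared. *)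
Lemma le_second_moment d (T : measurableType d) (P : probability T R)
    (W : T -> R) (v : R) : 0 <= v -> measurable_fun setT W ->
  (forall t, \int[P]_x (expR (t * W x))%:E = (expR (t ^+ 2 * v / 2))%:E)%E ->
  (\int[P]_x (W x ^+ 2)%:E <= v%:E)%E.
Proof.
move=> v0 mW mgf.
have mW2 : measurable_fun setT (fun x => (W x ^+ 2)%:E).
  by apply/measurable_EFinP; exact: measurable_funX.
have me t : measurable_fun setT (fun x => expR (t * W x)).
  by apply: measurableT_comp => //; exact: measurable_funM.
have meE t : measurable_fun setT (fun x => (expR (t * W x))%:E).
  exact/measurable_EFinP.
have W0 x : (0 <= (W x ^+ 2)%:E)%E by rewrite lee_fin sqr_ge0.
have key t : ((t ^+ 2)%:E * \int[P]_x (W x ^+ 2)%:E + 2%:E <=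
    (2 * expR (t ^+ 2 * v / 2))%:E)%E.
  have : (\int[P]_x (t ^+ 2 * W x ^+ 2 + 2)%:E <=
          \int[P]_x (expR (t * W x) + expR (- t * W x))%:E)%E.
    apply: le_integral_EFin => [||x].
    - by apply: measurable_funD => //; apply: measurable_funM => //; exact: measurable_funX.
    - exact: measurable_funD.
    - by rewrite -exprMn addr_ge0 ?sqr_ge0//= mulNr sqr_le_cosh.
  under eq_integral do rewrite EFinD EFinM.
  under [X in (_ <= X)%E]eq_integral do rewrite EFinD.
  rewrite ge0_integralD//; first last.
  - exact: emeasurable_funM.
  - by move=> x _; rewrite mule_ge0// lee_fin sqr_ge0.
  rewrite ge0_integralZl//; last by rewrite lee_fin sqr_ge0.
  rewrite [X in (_ <= X)%E]ge0_integralD//.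
  by rewrite !mgf sqrrN integral_cst_EFin -EFinD -mulr2n mulr_natl.
(* The case [t = 1] rules out an infinite second moment. *)
have := key 1; have : (0 <= \int[P]_x (W x ^+ 2)%:E)%E by exact: integral_ge0.
move: key; case: (\int[P]_x _)%E => [I key||//]; last by rewrite expr1n mul1e.
rewrite !lee_fin => I0 _.
have : I / 2 <= v / 2; last by lra.
apply: (@expR_linearize _ _ (v / 2) 0) => //; first lra.
(* The square root makes [t] itself the parameter of the linearization. *)
move=> t t0; have := key (Num.sqrt t).
rewrite (sqr_sqrtr (ltW t0)) -EFinM -EFinD lee_fin mulr0 addr0 mulrA.
lra.
Qed.

Lemma integral_iid_gauss_expR n (a : 'I_n -> R) :
  (\int[iid (gauss 0 1) n]_z (expR (\sum_(j < n) a j * tnth z j))%:E =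
   (expR ((\sum_(j < n) a j ^+ 2) / 2))%:E)%E.
Proof.
elim: n a => [a|n IH a].
  rewrite (eq_integral (fun=> 1%:E))//; last first.
    by move=> z _; rewrite big_ord0 expR0.
  by rewrite integral_cst_EFin big_ord0 mul0r expR0.
have ms m (b : 'I_m -> R) : measurable_fun setT
    (fun z : m.-tuple R => (expR (\sum_(j < m) b j * tnth z j))%:E).
  apply/measurable_EFinP; apply: measurableT_comp => //.
  apply: measurable_sum => j; apply: measurable_funM => //.
  exact: measurable_tnth.
have e0 (r : R) : (0 <= (expR r)%:E)%E by rewrite lee_fin expR_ge0.
rewrite /= ge0_integral_distribution//; last exact: ms.
have mc : measurable_fun setT ((fun z : n.+1.-tuple R =>
    (expR (\sum_(j < n.+1) a j * tnth z j))%:E) \o @cons_pair _ R n).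
  by apply: (measurableT_comp (ms _ a)); exact: measurable_cons_pair.
have c0 x : (0 <= ((fun z : n.+1.-tuple R =>
    (expR (\sum_(j < n.+1) a j * tnth z j))%:E) \o @cons_pair _ R n) x)%E.
  exact: e0.
rewrite [LHS](fubini_tonelli1 _ mc c0) /fubini_F.
pose S := \sum_(j < n) a (lift ord0 j) ^+ 2.
(* The terms [- 0] and [/ 1 ^+ 2] match [integral_gauss_expR] for mean 0 and deviation 1. *)
pose h (x : R) := (expR (a ord0 * (x - 0) / 1 ^+ 2))%:E.
transitivity (\int[gauss 0 1]_x ((expR (S / 2))%:E * h x))%E.
  apply: eq_integral => x _.
  rewrite -(IH (fun j => a (lift ord0 j))) muleC -ge0_integralZl//; last 2 first.
  - exact: (ms _ (fun j => a (lift ord0 j))).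
  - exact: e0.
  apply: eq_integral => z _.
  rewrite /= big_ord_recl /h -EFinM -expRD tnth0 subr0 expr1n divr1.
  by congr (expR (_ + _))%:E; apply: eq_bigr => j _; rewrite tnthS.
have mh : measurable_fun setT h.
  apply/measurable_EFinP; apply: measurableT_comp => //.
  by apply: measurable_funM => //; apply: measurable_funM => //; exact: measurable_funB.
have h0 x : (0 <= h x)%E by exact: e0.
rewrite ge0_integralZl//.
rewrite /h integral_gauss_expR ?oner_eq0// -EFinM -expRD big_ord_recl -/S.
by congr (expR _)%:E; field.
Qed.

Lemma le_second_moment_iid_gauss n (a : 'I_n -> R) :
  (\int[iid (gauss 0 1) n]_z ((\sum_(j < n) a j * tnth z j) ^+ 2)%:E <=
   (\sum_(j < n) a j ^+ 2)%:E)%E.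
Proof.
apply: le_second_moment.
- by apply: sumr_ge0 => j _; exact: sqr_ge0.
- apply: measurable_sum => j; apply: measurable_funM => //.
  exact: measurable_tnth.
- move=> t; rewrite mulr_sumr.
  under eq_bigr do rewrite -exprMn.
  rewrite -(integral_iid_gauss_expR (fun j => t * a j)); apply: eq_integral => z _.
  by rewrite mulr_sumr; under eq_bigr do rewrite mulrA.
Qed.

End gaussian_second_moment.

(** * Divergence of the n samples of the linear model *)

Section model_divergence.
Context (R : realType).

(** By independence, the conditional divergence in the chain rule is the constant [n%:R * k]. *)
Lemma kl_le_iid d (T : measurableType d) (P Q : probability T R) (k : R) n :
  0 <= k -> kl_le P Q k -> kl_le (iid P n) (iid Q n) (n%:R * k).
Proof.
move=> k0 PQ; elim: n => [|n IH]; first by rewrite mul0r; exact: kl_le_refl.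
rewrite -natr1 mulrDl mul1r addrC.
apply: (@kl_le_mixture _ _ _ _ _ _ _ P Q (iid P n) (iid Q n)
  (@cons_pair _ T n) (@cons_pair _ T n) (fun=> n%:R * k)) => //.
- by move=> _; rewrite mulr_ge0.
- by rewrite integral_cst_EFin.
move=> x g M mg gM; apply: (IH (fun y => g (cons_pair (x, y))) M).
- apply: (measurableT_comp mg).
  by apply: (measurableT_comp (@measurable_cons_pair _ T n)); exact: measurable_pair1.
- by move=> y; exact: gM.
Qed.

Lemma le_second_moment_mvnormal d (Sigma : 'M[R]_d) (beta : 'cV[R]_d) :
  posdefmx Sigma ->
  (\int[mvnormal Sigma]_x ((\sum_(j < d) tnth x j * beta j 0) ^+ 2)%:E <=
   ((beta^T *m Sigma *m beta) 0 0)%:E)%E.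
Proof.
move=> /posdefmx_factor exB; rewrite /mvnormal.
(* [posdefmx_factor] guarantees a genuine factor of [Sigma] rather than the default 0. *)
set A := xget 0 _; have AE : A *m A^T = Sigma by exact: (@xgetPex _ 0 _ exB).
have ml : measurable_fun setT
    (fun x : d.-tuple R => ((\sum_(j < d) tnth x j * beta j 0) ^+ 2)%:E).
  apply/measurable_EFinP; apply: measurable_funX.
  apply: measurable_sum => j; apply: measurable_funM => //.
  exact: measurable_tnth.
rewrite ge0_integral_distribution//; last by move=> x; rewrite lee_fin sqr_ge0.
(* A linear form in A Z with coefficients [beta] is one in Z with coefficients [A^T *m beta]. *)
pose a (j : 'I_d) := (A^T *m beta) j 0.
have -> : (beta^T *m Sigma *m beta) 0 0 = \sum_(j < d) a j ^+ 2.
  rewrite -AE mulmxA -mulmxA -[beta^T *m A]trmxK trmx_mul trmxK mxE.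
  by apply: eq_bigr => j _; rewrite mxE expr2.
apply: le_trans (le_second_moment_iid_gauss a).
rewrite le_eqVlt; apply/orP; left; apply/eqP; apply: eq_integral => z _.
rewrite /comp; congr (_ ^+ 2)%:E.
under eq_bigr do rewrite tnth_mktuple mulr_suml.
rewrite exchange_big/=; apply: eq_bigr => j _.
rewrite /a mxE mulr_suml; apply: eq_bigr => i _; rewrite mxE; ring.
Qed.

(** The covariates have the same law in both models. Given them, the responses are normal with means
    [c x] and 0, at divergence [c x ^+ 2 / 2 / sigma2], which is averaged over [x]. *)
Lemma kl_le_linear_model d (beta : 'cV[R]_d) (Sigma : 'M[R]_d) (sigma2 : R) :
  posdefmx Sigma -> 0 < sigma2 ->
  kl_le (linear_model beta Sigma sigma2) (linear_model 0 Sigma sigma2)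
    ((beta^T *m Sigma *m beta) 0 0 / 2 / sigma2).
Proof.
move=> pS s2; rewrite -[X in kl_le _ _ X]add0r.
pose c (x : d.-tuple R) := \sum_(j < d) tnth x j * beta j 0.
have mc : measurable_fun setT c.
  apply: measurable_sum => j; apply: measurable_funM => //.
  exact: measurable_tnth.
have s0 : Num.sqrt sigma2 != 0 by rewrite gt_eqF ?sqrtr_gt0.
have kE q : q / 2 / sigma2 = (2 * sigma2)^-1 * q by rewrite -mulrA -invfM mulrC.
have i0 : 0 <= (2 * sigma2)^-1 by rewrite invr_ge0 mulr_ge0// ltW.
apply: (@kl_le_mixture _ _ _ _ _ _ _ (mvnormal Sigma) (mvnormal Sigma)
  (gauss 0 (Num.sqrt sigma2)) (gauss 0 (Num.sqrt sigma2))
  (respond beta) (respond 0) (fun x => (2 * sigma2)^-1 * c x ^+ 2)).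
- by apply: measurable_funM => //; exact: measurable_funX.
- by move=> x; rewrite mulr_ge0// sqr_ge0.
- under eq_integral do rewrite EFinM.
  have mc2 : measurable_fun setT (fun x => (c x ^+ 2)%:E).
    by apply/measurable_EFinP; exact: measurable_funX.
  have c20 x : setT x -> (0 <= (c x ^+ 2)%:E)%E by rewrite lee_fin sqr_ge0.
  have i0E : (0 <= (2 * sigma2)^-1%:E)%E by rewrite lee_fin.
  rewrite (ge0_integralZl _ measurableT mc2 c20 i0E).
  rewrite kE EFinM; apply: lee_wpmul2l => //.
  exact: le_second_moment_mvnormal.
- exact: kl_le_refl.
move=> x g M mg gM.
have mpair : measurable_fun setT (fun e : R => (x, e)) by exact: measurable_pair1.
have mgx : measurable_fun setT (fun e : R => g (x, e)).
  exact: (measurableT_comp mg mpair).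
have gMx e : 1 <= g (x, e) <= M by exact: gM.
have mlng : measurable_fun setT (fun e : R => (ln (g (x, e)))%:E).
  by apply/measurable_EFinP; exact: measurableT_comp.
have lng0 e : (0 <= (ln (g (x, e)))%:E)%E.
  by rewrite lee_fin ln_ge0//; case/andP: (gMx e).
have H := kl_le_gauss (c x) s0 mgx gMx.
rewrite (sqr_sqrtr (ltW s2)) kE in H.
have -> : (\int[gauss 0 (Num.sqrt sigma2)]_e (g (respond 0 (x, e)))%:E =
    \int[gauss 0 (Num.sqrt sigma2)]_e (g (x, e))%:E)%E.
  apply: eq_integral => e _; rewrite /respond/=; congr (g (_, _))%:E.
  by rewrite big1 ?add0r// => j _; rewrite mxE mulr0.
apply: le_trans H; rewrite le_eqVlt; apply/orP; left; apply/eqP.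
exact: (integral_gauss_translate (c x) s0 mlng lng0).
Qed.

End model_divergence.

(** * Fano's inequality for disjoint events *)

Section fano.
Context (R : realType).

Lemma fano d (T : measurableType d) m (P : 'I_m.+1 -> probability T R)
    (Q : probability T R) (A : 'I_m.+1 -> set T) (K : R) :
  (forall j, measurable (A j)) -> trivIset setT A ->
  (forall j, kl_le (P j) Q K) ->
  (\sum_j fine (P j (A j))) * ln m.+1%:R <= m.+1%:R * (K + ln 2).
Proof.
move=> mA tA PQ.
pose p j := fine (P j (A j)); pose q j := fine (Q (A j)).
have pE j : P j (A j) = (p j)%:E by rewrite fineK// fin_num_measure.
have qE j : Q (A j) = (q j)%:E by rewrite fineK// fin_num_measure.
have q1 : \sum_j q j <= 1.
  rewrite -lee_fin -sumEFin; under eq_bigr do rewrite -qE.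
  rewrite -measure_bigsetU_ord//.
  by apply: probability_le1; exact: bigsetU_measurable.
have mi j : measurable_fun setT (fun x => \1_(A j) x : R) by exact: measurable_indic.
have step j : p j * ln m.+1%:R <= K + ln 2 + (m%:R * q j - 1) / 2.
  pose g x : R := 1 + m%:R * \1_(A j) x.
  have mg : measurable_fun setT g by apply: measurable_funD => //; exact: measurable_funM.
  have gM x : 1 <= g x <= m.+1%:R.
    rewrite /g indicE -nat1r lerDl lerD2l; case: (_ \in _).
      by rewrite mulr1 lexx ler0n.
    by rewrite mulr0 lexx ler0n.
  have := PQ j g _ mg gM.
  have -> : (\int[P j]_x (ln (g x))%:E = (p j * ln m.+1%:R)%:E)%E.
    have l0 : (0 <= (ln m.+1%:R : R)%:E)%E by rewrite lee_fin ln_ge0// ler1n.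
    transitivity (\int[P j]_x ((ln m.+1%:R)%:E * (\1_(A j) x)%:E))%E.
      apply: eq_integral => x _; rewrite -EFinM /g indicE.
      by case: (_ \in _); rewrite ?mulr1 ?mulr0 ?addr0 ?ln1// nat1r.
    rewrite ge0_integralZl//; last exact/measurable_EFinP.
    by rewrite integral_indic// setIT [X in (_ * X)%E]pE -EFinM mulrC.
  have -> : (\int[Q]_x (g x)%:E = (1 + m%:R * q j)%:E)%E.
    under eq_integral do rewrite EFinD EFinM.
    have miE : measurable_fun setT (fun x => (\1_(A j) x : R)%:E).
      exact/measurable_EFinP.
    rewrite ge0_integralD//; last exact: emeasurable_funM.
    rewrite integral_cst_EFin ge0_integralZl//.
    by rewrite integral_indic// setIT [X in (_ * X)%E]qE -EFinM -EFinD.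
  rewrite lee_fin/= => /le_trans; apply.
  have q0 : 0 <= q j by rewrite -lee_fin -qE.
  have x0 : 0 < 1 + m%:R * q j by rewrite ltr_wpDr// mulr_ge0.
  (* The average over [j] of [1 + m%:R * q j] is below 2, so the tangent at 2 leaves corrections
     whose sum is negative. *)
  have := @ln_tangent R _ 2 x0 ltac:(lra); lra.
rewrite mulr_suml; apply: (le_trans (ler_sum _ (fun j _ => step j))).
rewrite big_split/= -mulr_suml sumrB -mulr_sumr !sumr_const card_ord.
rewrite -[X in X + _ <= _]mulr_natl gerDl.
rewrite pmulr_lle0// subr_le0 -natr1 -[X in X + 1]mulr1.
by rewrite (le_trans (ler_wpM2l _ q1))// lerDl.
Qed.

End fano.

(** * Scalar covariance matrices *)

Section scalar_covariance.
Context (R : realType).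

Lemma posdefmx_scalar n (a : R) : 0 < a -> posdefmx (a%:M : 'M[R]_n).
Proof.
move=> a0; split=> [|v v0]; first exact: tr_scalar_mx.
rewrite mul_mx_scalar -scalemxAl mxE pmulr_rgt0// mxE.
have [i vi] : exists i, v i 0 != 0.
  apply/existsP; apply: contra_neqT v0 => /existsPn v0.
  by apply/colP => i; rewrite mxE; apply/eqP; rewrite -[_ == _]negbK v0.
rewrite (bigD1 i)//= ltr_pwDl//; first by rewrite mxE -expr2 exprn_even_gt0.
by apply: sumr_ge0 => k _; rewrite mxE -expr2 sqr_ge0.
Qed.

Lemma lambda_min_scalar n (a : R) : (0 < n)%N -> lambda_min (a%:M : 'M[R]_n) = a.
Proof.
case: n => // n _; rewrite /lambda_min (_ : [set b | _] = [set a]) ?inf1//.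
apply/seteqP; split=> [b /= /eigenvalueP[v vE v0]|_ ->/=].
  apply/eqP; rewrite -subr_eq0 -(mulIr_eq0 _ (@mulIf _ 1 _)) ?oner_eq0//.
  move: vE; rewrite mul_mx_scalar => /eqP; rewrite eq_sym -subr_eq0 -scalerBl.
  by rewrite scaler_eq0 (negbTE v0) orbF mulr1.
apply/eigenvalueP; exists (const_mx 1); first by rewrite mul_mx_scalar.
by apply/eqP => /rowP/(_ ord0); rewrite !mxE => /eqP; rewrite oner_eq0.
Qed.

(** [S :\: T] and [T] are disjoint, so the cross block of a scalar matrix is 0 and the Schur
    correction vanishes. *)
Lemma condmx_scalar d (a : R) (S T : {set 'I_d}) :
  condmx (a%:M) S T = a%:M.
Proof.
rewrite /condmx (_ : selmx a%:M (S :\: T) T = 0) ?mul0mx ?subr0.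
  by apply/matrixP => i j; rewrite !mxE (inj_eq enum_val_inj).
apply/matrixP => i j; rewrite !mxE; case: eqP => // ij.
by have := enum_valP i; rewrite ij inE enum_valP.
Qed.

Lemma scalar_in_Omega d sbar (a : R) : 0 < a ->
  Omega sbar a (a%:M : 'M[R]_d).
Proof.
move=> a0; split=> [|S T _ _ ST]; first exact: posdefmx_scalar.
by rewrite condmx_scalar lambda_min_scalar// card_gt0 finset.setD_eq0.
Qed.

End scalar_covariance.

(** * Minimax lower bound for support recovery *)

Theorem theorem4p2 (R : realType) (d sbar n : nat)
    (beta_min sigma2 omega delta : R)
    (hd : (0 < d)%N) (hs : (0 < sbar)%N) (hsd : sbar%:R <= d%:R / 2 :> R)
    (hbeta : 0 < beta_min) (hsigma : 0 < sigma2)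
    (homega : 0 < omega < 1) (hdelta : 0 < delta < 1 / 2)
    (hn : n%:R <= (1 - 2 * delta) *
            (ln d%:R / (beta_min ^+ 2 * omega / sigma2))) :
  ((delta - ln 2 / ln d%:R)%:E <=
   ereal_inf [set ereal_sup [set error_prob Shat theta |
                theta in Mbar d sbar beta_min omega sigma2] |
              Shat in estimator R d n])%E.
Proof.
have /andP[omega0 _] := homega; have /andP[delta0 _] := hdelta.
(* The bounds on [sbar] force d to be at least 2, so [ln d%:R] is positive and can be divided by. *)
have d2 : 1 < d%:R :> R by have : 1 <= sbar%:R :> R; [rewrite ler1n | lra].
case: d => [//|m] in hd hsd hn d2 *.
have lnd0 : 0 < ln m.+1%:R :> R by rewrite ln_gt0.
apply/ereal_infP => _ [Shat mShat <-].
rewrite leNgt; apply/negP => sup_lt; set r := delta - _ in sup_lt.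
pose beta (j : 'I_m.+1) : 'cV[R]_m.+1 := beta_min *: delta_mx j 0.
have betaE j i : beta j i 0 = beta_min * (i == j)%:R.
  by rewrite !mxE eqxx andbT.
have suppE j : supp (beta j) = [set j]%SET.
  by apply/setP => i; rewrite !inE betaE mulf_eq0 gt_eqF//= pnatr_eq0 eqb0 negbK.
pose Sigma : 'M[R]_m.+1 := omega%:M.
have pS : posdefmx Sigma by exact: posdefmx_scalar.
pose A j : set (n.-tuple (m.+1.-tuple R * R)) := Shat @^-1` [set [set j]%SET].
have mA j : measurable (A j) by exact: mShat.
pose P j := iid (linear_model (beta j) Sigma sigma2) n.
(* Each [beta j] has quadratic form [beta_min ^+ 2 * omega] under [Sigma]. *)
pose K := n%:R * (beta_min ^+ 2 * omega / 2 / sigma2).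
have kl j : kl_le (P j) (iid (linear_model 0 Sigma sigma2) n) K.
  apply: kl_le_iid.
    by rewrite !divr_ge0// ?mulr_ge0 ?sqr_ge0 ?ltW.
  rewrite (_ : _ * omega = ((beta j)^T *m Sigma *m beta j) 0 0).
    exact: kl_le_linear_model.
  rewrite mul_mx_scalar -scalemxAl mxE mxE (bigD1 j)//= big1 => [|i ij].
    by rewrite mxE !betaE eqxx mulr1 addr0 -expr2 mulrC.
  by rewrite mxE betaE (negbTE ij) mulr0 mul0r.
have tA : trivIset setT A.
  apply/trivIsetP => i j _ _ ij; apply/seteqP; split=> // x [xi xj].
  by move: ij; rewrite (finset.set1_inj (etrans (esym xi) xj)) eqxx.
(* Under hypothesis [j] the error event is the complement of [A j], and the model lies in the class
   because its support is a singleton. *)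
have PA j : 1 - r <= fine (P j (A j)).
  have : (P j (~` A j) < r%:E)%E.
    apply: le_lt_trans sup_lt; apply: ereal_sup_ubound.
    exists (beta j, Sigma, sigma2).
      split=> //=; last exact: scalar_in_Omega.
      rewrite /Theta/= suppE cards1; split=> // i; rewrite inE => /eqP ->.
      by rewrite betaE eqxx mulr1 ger0_norm// ltW.
    rewrite /error_prob /= suppE; congr (P j _).
    by apply/seteqP; split => x /= /eqP.
  rewrite probability_setC// -[P j (A j)]fineK ?fin_num_measure//.
  by rewrite -EFinB lte_fin; lra.
have := fano mA tA kl.
have sumA : m.+1%:R * (1 - r) <= \sum_j fine (P j (A j)).
  rewrite mulr_natl -[X in _ *+ X](card_ord m.+1) -sumr_const.
  exact: ler_sum.
apply/negP; rewrite -ltNge.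
apply: lt_le_trans (ler_wpM2r (ltW lnd0) sumA).
rewrite -mulrA ltr_pM2l ?ltr0n//.
(* What remains is [K + ln 2 < (1 - r) * ln m.+1%:R]. By the definition of [r] this is
   [K < (1 - delta) * ln m.+1%:R], while the sample bound gives
   [2 * K <= (1 - 2 * delta) * ln m.+1%:R]. *)
have rE : r * ln m.+1%:R = delta * ln m.+1%:R - ln 2.
  by rewrite mulrBl divfK ?gt_eqF.
have KE : 2 * K <= (1 - 2 * delta) * ln m.+1%:R.
  have b0 : 0 < beta_min ^+ 2 * omega / sigma2 by rewrite divr_gt0// mulr_gt0// exprn_gt0.
  move: hn; rewrite mulrA ler_pdivlMr//; apply: le_trans.
  by rewrite le_eqVlt; apply/orP; left; apply/eqP; rewrite /K; field; rewrite gt_eqF.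
by rewrite mulrBl mul1r rE; lra.
Qed.
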